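(* Let $m$ and $e$ be integers with $2\le e\le m$. If $S\in\mathcal{L}(m,e)$, then $[S]\cap\mathcal{C}(m,e)=\{\phi(S)\}$.
   Context: $\mathbb{N}=\{0,1,2,\ldots\}$. A numerical semigroup is a subset $S\subseteq\mathbb{N}$ closed under addition, with $0\in S$ and $\mathbb{N}\setminus S$ finite. The multiplicity $m(S)$ is the least positive integer in $S$. Every numerical semigroup has a unique minimal (with respect to inclusion) system of generators, which is finite; it is denoted $\mathrm{msg}(S)$, and its cardinality $e(S)$ is the embedding dimension of $S$. $\mathcal{L}(m,e)$ is the set of all numerical semigroups with multiplicity $m$ and embedding dimension $e$. A numerical semigroup $S$ is packed if $\mathrm{msg}(S)\subseteq\{m(S),m(S)+1,\ldots,2m(S)-1\}$; $\mathcal{C}(m,e)$ is the set of packed numerical semigroups in $\mathcal{L}(m,e)$. For $S\in\mathcal{L}(m,e)$, $\phi(S)$ denotes the numerical semigroup generated by $\{m+(x\bmod m)\mid x\in\mathrm{msg}(S)\}$, where $x\bmod m\in\{0,\ldots,m-1\}$ is the remainder of $x$ upon division by $m$. On $\mathcal{L}(m,e)$ define the equivalence relation $S\,\mathcal{R}\,T$ if and only if $\phi(S)=\phi(T)$, and let $[S]=\{T\in\mathcal{L}(m,e)\mid S\,\mathcal{R}\,T\}$. *)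

(* Defs.v *)
From HB Require Import structures.
From mathcomp Require Import all_boot.
From mathcomp Require Import boolp classical_sets functions cardinality.

Set Implicit Arguments.
Unset Strict Implicit.
Unset Printing Implicit Defensive.

Local Open Scope nat_scope.
Local Open Scope classical_set_scope.
Local Open Scope card_scope.

Definition submonoid (S : set nat) : Prop :=
  S 0 /\ forall x y, S x -> S y -> S (x + y).

Definition generated (A : set nat) : set nat := smallest submonoid A.

Definition numerical_semigroup (S : set nat) : Prop :=
  submonoid S /\ finite_set (~` S).

(* The default value 0 of [xget] is only taken when S has no positive
   element, which never happens for a numerical semigroup. *)
Definition multiplicity (S : set nat) : nat :=
  xget 0 [set m | [/\ S m, 0 < m & forall n, S n -> 0 < n -> m <= n]].

Definition minimal_generating_system (S A : set nat) : Prop :=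
  generated A = S /\ forall B, B `<=` A -> generated B = S -> B = A.

(* Every submonoid of nat has exactly one minimal generating system, so the
   choice made by [xget] is forced and its default value set0 is irrelevant. *)
Definition msg (S : set nat) : set nat :=
  xget set0 [set A | minimal_generating_system S A].

(* [msg S #= `I_e] says that the embedding dimension of S is e. *)
Definition semigroups_of (m e : nat) : set (set nat) :=
  [set S | [/\ numerical_semigroup S, multiplicity S = m & msg S #= `I_e]].

Definition packed (S : set nat) : Prop :=
  msg S `<=` [set n | multiplicity S <= n <= 2 * multiplicity S - 1].

Definition packed_semigroups_of (m e : nat) : set (set nat) :=
  [set S | semigroups_of m e S /\ packed S].

(* Here m stands for the multiplicity of S. *)
Definition phi (m : nat) (S : set nat) : set nat :=
  generated [set m + x %% m | x in msg S].

Definition eqR (m : nat) (S T : set nat) : Prop := phi m S = phi m T.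

Definition eqR_class (m e : nat) (S : set nat) : set (set nat) :=
  [set T | semigroups_of m e T /\ eqR m S T].

(* Main.v *)
Require Import Defs.
From mathcomp Require Import all_boot.
From mathcomp Require Import boolp classical_sets functions cardinality.
From mathcomp Require Import zify.

(** The minimal generating system of a submonoid of nat is its set of atoms
    (positive elements that are not sums of two positive elements). Distinct
    atoms of [S] are incongruent modulo [m], since [m] belongs to [S]; so
    [x |-> m + x %% m] is injective on them, and its image lies in
    [[m, 2m - 1]]. A sum of two positive elements of the submonoid generated by
    such an image is at least [2m], hence the image consists of atoms and is
    the minimal generating system of [phi m S]. Moreover [phi m S] contains [m]
    and meets every residue class that [S] meets, so it is cofinite. On a
    packed semigroup the map fixes the generators, so [phi m] is the identity
    there. *)

Set Implicit Arguments.
Unset Strict Implicit.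
Unset Printing Implicit Defensive.

Local Open Scope nat_scope.
Local Open Scope classical_set_scope.

Definition atoms (S : set nat) : set nat :=
  [set x | [/\ S x, 0 < x &
    forall y z, S y -> S z -> 0 < y -> 0 < z -> x <> y + z]].

Lemma generated_submonoid (A : set nat) : submonoid (generated A).
Proof.
split=> [B [[B0 _] _] //|x y Ax Ay B BA].
by case: (BA) => -[_ BD] _; apply: BD; [exact: Ax|exact: Ay].
Qed.

Lemma sub_generated (A : set nat) : A `<=` generated A.
Proof. by move=> x Ax B [_]; apply. Qed.

Lemma generated_sub (A S : set nat) :
  submonoid S -> A `<=` S -> generated A `<=` S.
Proof. by move=> Ssub AS x; apply. Qed.

Lemma submonoid_muln (S : set nat) (k x : nat) :
  submonoid S -> S x -> S (k * x).
Proof.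
by move=> [S0 SD] Sx; elim: k => [|k IH]; rewrite ?mul0n ?mulSn //; apply: SD.
Qed.

(** Strong induction: a positive non-atom splits into two strictly smaller positive elements. *)
Lemma generated_atoms (S : set nat) : submonoid S -> generated (atoms S) = S.
Proof.
move=> Ssub; apply/seteqP; split; first by apply: generated_sub => // x [].
have [gen0 genD] := generated_submonoid (atoms S).
move=> x; have [n] := ubnP x; elim: n x => // n IH x ltxn Sx.
have [->//|x_gt0] := posnP x.
have [/sub_generated//|xNatom] := pselect (atoms S x).
have [y [z [Sy Sz y_gt0 z_gt0 xE]]] :
    exists y z, [/\ S y, S z, 0 < y, 0 < z & x = y + z].
  apply: contrapT => nosum; apply: xNatom; split=> // y z Sy Sz y0 z0 xE.
  by apply: nosum; exists y, z.
by rewrite xE; apply: genD; apply: IH => //; lia.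
Qed.

(** If an atom [x] were not in [A], then [generated A] without [x] would still be a submonoid
    containing [A], contradicting that [generated A] is the smallest one. *)
Lemma atoms_sub_generators (A : set nat) : atoms (generated A) `<=` A.
Proof.
move=> x [genx x_gt0 xatom]; apply: contrapT => xNA.
have [gen0 genD] := generated_submonoid A.
have sub : submonoid [set y | generated A y /\ y <> x]; last first.
  have AsubD : A `<=` [set y | generated A y /\ y <> x].
    by move=> y Ay; split; [exact: sub_generated|move=> yx; rewrite yx in Ay].
  by have [_] := generated_sub sub AsubD genx.
split=> [|y z [geny ynx] [genz znx]]; first by split=> //; lia.
split; first exact: genD.
have [->//|y_gt0] := posnP y; have [->|z_gt0] := posnP z; first by rewrite addn0.
by move=> /esym; apply: xatom.
Qed.

(** The atoms generate [S] and lie in every generating set, so no other set is minimal; they also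
    witness that [xget] does not return its default. *)
Lemma msg_atoms (S : set nat) : submonoid S -> msg S = atoms S.
Proof.
move=> Ssub; have genS := generated_atoms Ssub.
rewrite /msg; case: xgetP => [A _ [genA minA]|/(_ (atoms S)) []].
  by apply/esym/minA => //; rewrite -genA; apply: atoms_sub_generators.
split=> // B BA genB; apply/seteqP; split=> //.
by rewrite -genB; exact: atoms_sub_generators.
Qed.

Lemma msg_generated (A : set nat) :
  A `<=` atoms (generated A) -> msg (generated A) = A.
Proof.
move=> Aatoms; rewrite msg_atoms; last exact: generated_submonoid.
by apply/seteqP; split=> //; exact: atoms_sub_generators.
Qed.

Lemma generated_msg (S : set nat) : submonoid S -> generated (msg S) = S.
Proof. by move=> Ssub; rewrite msg_atoms ?generated_atoms. Qed.

Lemma multiplicityP (S : set nat) (m : nat) : 0 < m ->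
  multiplicity S = m <->
  [/\ S m, 0 < m & forall n, S n -> 0 < n -> m <= n].
Proof.
move=> m_gt0; rewrite /multiplicity; split.
  (* The default value 0 of [xget] is excluded by [0 < m]. *)
  by case: xgetP => [_ -> H <- //|_ mE]; rewrite -mE in m_gt0.
move=> [Sm _ mmin]; case: xgetP => [k _ [Sk k_gt0 kmin]|/(_ m) []//].
by apply/eqP; rewrite eqn_leq kmin ?mmin.
Qed.

(** If [x < y] are congruent, then [y = x + k * m] splits [y] into two positive elements of [S]. *)
Lemma atoms_modn_inj (S : set nat) (m x y : nat) : submonoid S -> S m ->
  atoms S x -> atoms S y -> x = y %[mod m] -> x = y.
Proof.
move=> Ssub Sm; wlog ltxy : x y / x < y.
  move=> H ax ay exy; have [/H|/H|//] := ltngtP x y; first exact.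
  by move=> /(_ ay ax (esym exy)).
move=> [Sx x_gt0 _] [_ _ yatom] /esym/eqP; rewrite eqn_mod_dvd 1?ltnW //.
move=> /dvdnP[k ykE].
by case: (yatom x (k * m)) => //; [exact: submonoid_muln|lia|lia].
Qed.

Lemma finite_setC_residues (T : set nat) (m : nat) : 0 < m -> submonoid T ->
  T m -> (forall n, exists y, T y /\ y = n %[mod m]) -> finite_set (~` T).
Proof.
move=> m_gt0 Tsub Tm /choice[f fP].
(* The bound is the largest of the chosen representatives [f r]: any [n] from there on is
   [f (n %% m)] plus a multiple of [m]. *)
apply: sub_finite_set (finite_II (\max_(r < m) f r)) => n nT.
rewrite /= ltnNge; apply/negP => maxn; apply: nT.
have [Tf] := fP (n %% m); rewrite modn_mod => /esym/eqP.
have lefn : f (n %% m) <= n.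
  apply: leq_trans maxn.
  exact: (leq_bigmax (Ordinal (ltn_pmod n m_gt0))).
rewrite eqn_mod_dvd // => /dvdnP[k /eqP]; rewrite -(eqn_add2r (f (n %% m))).
rewrite subnK // => /eqP ->.
by apply Tsub => //; exact: submonoid_muln.
Qed.

(** Otherwise the infinite progression [k * m + n] would lie in the finite complement of [S]. *)
Lemma numerical_semigroup_residue (S : set nat) (m n : nat) : 0 < m ->
  numerical_semigroup S -> exists y, S y /\ y = n %[mod m].
Proof.
move=> m_gt0 [_ finS]; apply: contrapT => noy; apply: infinite_nat.
have inj : {in [set: nat] &, injective (fun k => k * m + n)}.
  by move=> j k _ _ /eqP; rewrite eqn_add2r eqn_pmul2r // => /eqP.
rewrite -(eq_finite_set (inj_card_eq inj)).
apply: sub_finite_set finS => _ [k _ <-] Sk.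
by apply: noy; exists (k * m + n); rewrite modnMDl.
Qed.

Lemma atom_multiplicity (S : set nat) (m : nat) : 0 < m ->
  multiplicity S = m -> atoms S m.
Proof.
move=> m_gt0 /(multiplicityP _ m_gt0)[Sm _ mmin]; split=> // y z Sy Sz y0 z0.
by have := mmin y Sy y0; lia.
Qed.

Lemma generated_window (m : nat) (A : set nat) :
  A `<=` [set n | m <= n <= 2 * m - 1] ->
  forall n, generated A n -> 0 < n -> m <= n.
Proof.
move=> Aw n genn n_gt0.
have sub : submonoid [set x | x = 0 \/ m <= x].
  split=> [|x y /= Hx Hy]; first by left.
  lia.
have AS : A `<=` [set x | x = 0 \/ m <= x].
  by move=> x /Aw /= /andP[mx _]; right.
by have /= := generated_sub sub AS genn; lia.
Qed.

Lemma msg_generated_window (m : nat) (A : set nat) : 0 < m ->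
  A `<=` [set n | m <= n <= 2 * m - 1] -> msg (generated A) = A.
Proof.
move=> m_gt0 Aw; apply: msg_generated => x Ax; have /= := Aw _ Ax => xw.
split; [exact: sub_generated|lia|] => y z geny genz y0 z0 xE.
have := generated_window Aw geny y0; have := generated_window Aw genz z0; lia.
Qed.

Lemma image_window (m : nat) (A : set nat) : 0 < m ->
  [set m + x %% m | x in A] `<=` [set n | m <= n <= 2 * m - 1].
Proof. by move=> m_gt0 _ [x _ <-] /=; have := ltn_pmod x m_gt0; lia. Qed.

Lemma image_window_id (m : nat) (A : set nat) : 0 < m ->
  A `<=` [set n | m <= n <= 2 * m - 1] -> [set m + x %% m | x in A] = A.
Proof.
move=> m_gt0 Aw; have fid x : A x -> m + x %% m = x.
  move=> /Aw /= xw; have <- : m + (x - m) = x by lia.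
  by rewrite modnDl modn_small //; lia.
apply/seteqP; split=> [_ [x Ax <-]|x Ax]; first by rewrite fid.
by exists x; rewrite ?fid.
Qed.

Lemma msg_phi (m : nat) (S : set nat) : 0 < m ->
  msg (phi m S) = [set m + x %% m | x in msg S].
Proof. by move=> m_gt0; exact: msg_generated_window (image_window m_gt0). Qed.

Lemma phi_packed (m : nat) (S : set nat) : 0 < m -> submonoid S ->
  multiplicity S = m -> packed S -> phi m S = S.
Proof.
move=> m_gt0 Ssub mS Sp; rewrite /phi image_window_id ?generated_msg //.
by rewrite -mS.
Qed.

(** The numbers whose residue class meets [phi m S] form a submonoid; it contains [msg S], hence all
    of [S]. *)
Lemma phi_residue (m : nat) (S : set nat) (x : nat) : submonoid S -> S x ->
  exists y, phi m S y /\ y = x %[mod m].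
Proof.
move=> Ssub Sx; have [gen0 genD] : submonoid (phi m S).
  exact: generated_submonoid.
have sub : submonoid [set x | exists y, phi m S y /\ y = x %[mod m]].
  split=> [|u v [y [Ty yu]] [z [Tz zv]]]; first by exists 0.
  by exists (y + z); split; [exact: genD|rewrite -modnDm yu zv modnDm].
have msgS : msg S `<=` [set x | exists y, phi m S y /\ y = x %[mod m]].
  move=> u Su; exists (m + u %% m); rewrite modnDl modn_mod; split=> //.
  by apply: sub_generated; exists u.
by apply: (generated_sub sub msgS); rewrite generated_msg.
Qed.

Lemma phi_semigroups_of (m e : nat) (S : set nat) : 0 < m ->
  semigroups_of m e S -> semigroups_of m e (phi m S).
Proof.
move=> m_gt0 [Sns mS eS]; have [Ssub _] := Sns.
have Tsub : submonoid (phi m S) by exact: generated_submonoid.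
have /(multiplicityP _ m_gt0)[Sm _ _] := mS.
have Tm : phi m S m.
  (* The multiplicity is itself an atom, and the map [m + x %% m] fixes it. *)
  apply: sub_generated; exists m; last by rewrite modnn addn0.
  by rewrite msg_atoms //; exact: atom_multiplicity.
split.
- split=> //; apply: (finite_setC_residues m_gt0 Tsub Tm) => n.
  have [x [Sx <-]] := numerical_semigroup_residue n m_gt0 Sns.
  exact: phi_residue.
- by apply/multiplicityP => //; split=> //; exact/generated_window/image_window.
- rewrite msg_phi //; apply: card_eq_trans eS; apply: inj_card_eq => x y.
  rewrite !inE msg_atoms // => ax ay /addnI; exact: atoms_modn_inj ax ay.
Qed.

Theorem lemma2 (m e : nat) (he2 : 2 <= e) (hem : e <= m) (S : set nat)
    (hS : semigroups_of m e S) :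
  eqR_class m e S `&` packed_semigroups_of m e = [set phi m S].
Proof.
have m_gt0 : 0 < m by apply: leq_trans hem; exact: ltnW.
(* A packed [T] in the class satisfies [T = phi m T = phi m S]. Conversely [phi m S] is packed,
   hence fixed by [phi m], which puts it in the class of [S]. *)
apply/seteqP; split=> [T [[_ ST] [[[Tsub _] mT _] Tp]]|_ ->].
  by rewrite /= ST phi_packed.
have hT := phi_semigroups_of m_gt0 hS; have [[Tsub _] mT _] := hT.
have Tp : packed (phi m S) by rewrite /packed mT msg_phi //; exact: image_window.
by do 2!split=> //; rewrite /eqR (phi_packed m_gt0 Tsub mT Tp).
Qed.
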